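(* Let $n\in\mathbb N$ and let $A$ be an $n\times n$ complex matrix all of whose eigenvalues have positive real parts. Let $\mu>0$, $f\in\mathcal F_E(-\mu,\mathbb C^n)$, $T\ge0$, and let $g\in C([T,\infty),\mathbb C^n)$ satisfy $g(t)=\mathcal O(e^{-(\mu+\delta)t})$ for some $\delta>0$. Assume that $y\in C([T,\infty),\mathbb C^n)$ is a solution of $$y'(t)+Ay(t)=f(t)+g(t)\quad\text{for }t>T,$$ and that for any $\lambda\in\operatorname{Re}\sigma(A)$ with $\lambda<\mu$ and any $m\in\mathbb N$, $$\lim_{t\to\infty}t^me^{\lambda t}|y(t)|=0.$$ Then there exist a function $z\in\mathcal F_E(-\mu,\mathbb C^n)$ and a number $\varepsilon>0$ such that $$z'(t)+Az(t)=f(t)\quad\text{for }t\in\mathbb R,$$ and $$|y(t)-z(t)|=\mathcal O(e^{-(\mu+\varepsilon)t}).$$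
   Context: $|\cdot|$ is the Euclidean norm; $\operatorname{Re}\sigma(A)=\{\operatorname{Re}\Lambda:\Lambda\text{ an eigenvalue of }A\}$; $u(t)=\mathcal O(h(t))$ means that there are $T',C>0$ with $|u(t)|\le Ch(t)$ for all $t\ge T'$. For $\mu\in\mathbb R$, $\mathcal F_E(\mu,\mathbb C^n)$ is the set of functions $g:\mathbb R\to\mathbb C^n$ of the form $g(t)=\sum_{\lambda\in S}p_\lambda(t)e^{\lambda t}$, where $S$ is a finite subset of $\mathbb C$ with $\operatorname{Re}\lambda=\mu$ for all $\lambda\in S$, and each $p_\lambda$ is a polynomial from $\mathbb R$ to $\mathbb C^n$. *)

(* Defs.v *)
From HB Require Import structures.
From mathcomp Require Export all_boot all_order all_algebra complex.
From mathcomp Require Export all_classical all_reals all_analysis.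
Export Order.TTheory GRing.Theory Num.Theory.
Export numFieldNormedType.Exports.

Set Implicit Arguments.
Unset Strict Implicit.
Unset Printing Implicit Defensive.

Local Open Scope classical_set_scope.
Local Open Scope ring_scope.
Local Open Scope complex_scope.

(* R[i] gets the topology of its modulus; the libraries only provide it for
   R[i] explicitly cast to a numFieldType. *)
HB.instance Definition _ (R : rcfType) :=
  NormedModule.copy R[i] (R[i] : numFieldType)^o.

Section Defs.
Variables (R : realType) (n : nat).

Definition cexp (z : R[i]) : R[i] :=
  (expR (complex.Re z))%:C * (cos (complex.Im z) +i* sin (complex.Im z)).

(* The norm `|v| of the library on matrices is the max norm, hence this one. *)
Definition enorm (v : 'cV[R[i]]_n) : R :=
  Num.sqrt (\sum_(i < n) Normc.normc (v i 0) ^+ 2).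

(* u'(t) = d, for a C^n-valued function of a real variable (the library's
   derivative needs source and target to have the same scalar field). *)
Definition is_vderive (u : R -> 'cV[R[i]]_n) (t : R) (d : 'cV[R[i]]_n) : Prop :=
  (h%:C)^-1 *: (u (t + h) - u t) @[h --> (0 : R)^'] --> d.

(* The library's [eigenvalue] is defined with row eigenvectors; for a square
   matrix over a field the eigenvalues are the same as with column ones. *)
Definition Re_spectrum (A : 'M[R[i]]_n) : set R :=
  [set complex.Re L | L in [set L | eigenvalue A L]].

Definition bigO_infty (u : R -> 'cV[R[i]]_n) (h : R -> R) : Prop :=
  exists T' C : R, [/\ 0 < T', 0 < C &
    forall t, T' <= t -> enorm (u t) <= C * h t].

(* A polynomial from R to C^n is given by its n coordinate polynomials. *)
Definition vpoly_eval (p : 'cV[{poly R[i]}]_n) (t : R) : 'cV[R[i]]_n :=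
  map_mx (fun q : {poly R[i]} => q.[t%:C]) p.

Definition F_E (mu : R) : set (R -> 'cV[R[i]]_n) :=
  [set g | exists (S : seq R[i]) (p : R[i] -> 'cV[{poly R[i]}]_n),
    [/\ uniq S,
        forall l, l \in S -> complex.Re l = mu &
        forall t, g t = \sum_(l <- S) cexp (l * t%:C) *: vpoly_eval (p l) t]].

(* u'(t) + A u(t) = rhs(t) for all t in D; differentiability is included. *)
Definition ode_solution (A : 'M[R[i]]_n) (rhs u : R -> 'cV[R[i]]_n)
    (D : set R) : Prop :=
  forall t, D t -> exists2 d, is_vderive u t d & d + A *m u t = rhs t.

End Defs.

(* Main.v *)
Require Import Defs.
From mathcomp Require Import spectral mxred ring lra.

Set Implicit Arguments.
Unset Strict Implicit.
Unset Printing Implicit Defensive.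

Local Open Scope classical_set_scope.
Local Open Scope ring_scope.
Local Open Scope complex_scope.

(** Writing P A = L P with L lower triangular, w = P y solves a triangular
    system, which is treated row by row: in row k the rows j < k are already
    split as w_j = z_j + O(exp(-(mu + eps) t)), and their contributions are
    absorbed in f_k and g_k.  It remains to treat v' + a v = f + g with a an
    eigenvalue of A.  Solving q' + (a + l) q = p in polynomials gives a
    particular solution z0 for f alone, and the derivative exp(a t) g of
    exp(a t) (v - z0) is O(exp(-k t)) with k = mu + delta - Re a.  If
    Re a <= mu, then exp(a t) (v - z0) tends to some c at the rate exp(-k t)
    and z = z0 + c exp(-a t); when Re a < mu the growth assumption forces
    c = 0.  If Re a > mu, delta may be decreased so that k < 0, and
    exp(a t) (v - z0) = O(exp(-k t)), so that z = z0.  All estimates come from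
    the mean value theorem; no integral is needed. *)

Local Notation normc := Normc.normc.
Local Notation Re := complex.Re.
Local Notation Im := complex.Im.

(** * Modulus, complex exponential and Euclidean norm *)

Section ComplexModulus.
Variable R : realType.
Implicit Types x y : R[i].

Lemma normr_normc x : `|x| = (normc x)%:C.
Proof. by []. Qed.

Lemma normc_ge0 x : 0 <= normc x.
Proof. by case: x => a b; exact: sqrtr_ge0. Qed.

Lemma Re_le_normc x : `|Re x| <= normc x.
Proof.
by case: x => a b /=; rewrite -sqrtr_sqr ler_wsqrtr// lerDl sqr_ge0.
Qed.

Lemma Im_le_normc x : `|Im x| <= normc x.
Proof.
by case: x => a b /=; rewrite -sqrtr_sqr ler_wsqrtr// lerDr sqr_ge0.
Qed.

Lemma normc_le_ReIm x : normc x <= `|Re x| + `|Im x|.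
Proof.
case: x => a b /=; rewrite -[leRHS]ger0_norm ?addr_ge0// -sqrtr_sqr.
rewrite ler_wsqrtr// sqrrD !real_normK ?num_real// -addrA lerD2l lerDr.
by rewrite mulrn_wge0// mulr_ge0.
Qed.

Lemma ReD x y : Re (x + y) = Re x + Re y.
Proof. by case: x; case: y. Qed.
Lemma ImD x y : Im (x + y) = Im x + Im y.
Proof. by case: x; case: y. Qed.
Lemma ReN x : Re (- x) = - Re x.
Proof. by case: x. Qed.
Lemma ImN x : Im (- x) = - Im x.
Proof. by case: x. Qed.
Lemma ReM x y : Re (x * y) = Re x * Re y - Im x * Im y.
Proof. by case: x; case: y. Qed.
Lemma ImM x y : Im (x * y) = Re x * Im y + Im x * Re y.
Proof. by case: x; case: y. Qed.

Lemma complex_eq x y : Re x = Re y -> Im x = Im y -> x = y.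
Proof. by case: x => a b; case: y => c d /= -> ->. Qed.

Lemma normc_sum (I : Type) (s : seq I) (P : pred I) (F : I -> R[i]) :
  normc (\sum_(i <- s | P i) F i) <= \sum_(i <- s | P i) normc (F i).
Proof.
elim/big_ind2: _ => [|x1 x2 y1 y2 h1 h2|//]; first by rewrite Normc.normc0.
by apply: le_trans (le_normcD _ _) _; exact: lerD.
Qed.

Lemma normc_cexp (z : R[i]) : normc (cexp z) = expR (Re z).
Proof.
rewrite /cexp Normc.normcM /= expr0n/= addr0 cos2Dsin2 sqrtr1 mulr1.
by rewrite sqrtr_sqr ger0_norm ?expR_ge0.
Qed.

Lemma cexpD (z w : R[i]) : cexp (z + w) = cexp z * cexp w.
Proof.
rewrite /cexp ReD ImD expRD cosD sinD; apply: complex_eq;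
rewrite !(ReM, ImM) /=; ring.
Qed.

Lemma cexp0 : cexp 0 = 1 :> R[i].
Proof.
rewrite /cexp /= expR0 cos0 sin0.
by apply: complex_eq; rewrite !(ReM, ImM) /=; ring.
Qed.

Lemma enorm_ge (n : nat) (v : 'cV[R[i]]_n) i : normc (v i 0) <= enorm v.
Proof.
rewrite -[leLHS]ger0_norm ?normc_ge0// -sqrtr_sqr ler_wsqrtr//.
by rewrite (bigD1 i)//= lerDl sumr_ge0// => j _; exact: sqr_ge0.
Qed.

Lemma enorm_le (n : nat) (v : 'cV[R[i]]_n) : enorm v <= \sum_i normc (v i 0).
Proof.
have s0 : 0 <= \sum_i normc (v i 0) by apply: sumr_ge0 => i _; exact: normc_ge0.
rewrite -[leRHS]ger0_norm// -sqrtr_sqr ler_wsqrtr//.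
(* Only one factor of the squared sum is expanded: each squared modulus is at most that modulus
   times the whole sum. *)
rewrite [leRHS]expr2 mulr_suml ler_sum// => i _; rewrite expr2.
rewrite ler_wpM2l ?normc_ge0// (bigD1 i)//= lerDl.
by apply: sumr_ge0 => j _; exact: normc_ge0.
Qed.

End ComplexModulus.

(** * Convergence and derivatives by real and imaginary parts *)

Section ComplexDerivative.
Variable R : realType.

Lemma cvg_complexP (T : Type) (F : set_system T) (FF : Filter F)
    (u : T -> R[i]) (l : R[i]) :
  u x @[x --> F] --> l <->
  Re (u x) @[x --> F] --> Re l /\ Im (u x) @[x --> F] --> Im l.
Proof.
split.
  move=> /cvgrPdist_lt ul; split; apply/cvgrPdist_lt => e e0;
  have e0' : 0 < e%:C :> R[i] by rewrite ltcR.
    apply: filterS (ul _ e0') => x; rewrite normr_normc ltcR; apply: le_lt_trans.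
    by have := Re_le_normc (l - u x); rewrite ReD ReN.
  apply: filterS (ul _ e0') => x; rewrite normr_normc ltcR; apply: le_lt_trans.
  by have := Im_le_normc (l - u x); rewrite ImD ImN.
move=> [/cvgrPdist_lt uR /cvgrPdist_lt uI]; apply/cvgrPdist_lt => e.
(* Positivity in the order of [R[i]] forces the imaginary part of [e] to be 0. *)
case: e => e1 e2; rewrite ltcE /= => /andP[/eqP-> e0].
have e20 : 0 < e1 / 2 by rewrite divr_gt0.
near=> x; rewrite normr_normc [_ +i* 0]complexr0 ltcR.
apply: le_lt_trans (normc_le_ReIm _) _.
rewrite ReD ImD ReN ImN [ltRHS](splitr e1) ltrD//.
  by near: x; exact: uR.
by near: x; exact: uI.
Unshelve. all: by end_near. Qed.

Lemma cvg_cVP (n : nat) (T : Type) (F : set_system T) (FF : Filter F)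
    (u : T -> 'cV[R[i]]_n) (l : 'cV[R[i]]_n) :
  u x @[x --> F] --> l <-> forall k, u x k 0 @[x --> F] --> l k 0.
Proof.
split=> [ul k|ul A [P lP PA]].
  move=> B lB; apply: (ul [set M | B (M k 0)]).
  (* A product neighbourhood that constrains entry [k] alone. *)
  exists (fun i j => [set x | i = k -> B x]) => [i j|M /= /(_ k 0)]; last by exact.
  rewrite ord1; have [->|ik] := eqVneq i k; first by apply: filterS lB => x Bx _.
  by apply: filterS filterT => x _ /eqP; rewrite (negPf ik).
have : \forall x \near F, forall k, P k 0 (u x k 0).
  by apply: filter_forall => k; exact: ul.
by apply: filterS => x Px; apply: PA => i j; rewrite ord1.
Qed.

(** Stated on real and imaginary parts so that real calculus and the mean value theorem apply;
    [cderive_cvgP] identifies it with the limit of difference quotients. *)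
Definition cderive (u : R -> R[i]) (t : R) (d : R[i]) : Prop :=
  is_derive t 1 (fun x => Re (u x)) (Re d) /\
  is_derive t 1 (fun x => Im (u x)) (Im d).

Lemma is_derive_cvgP (f : R -> R) (t d : R) :
  is_derive t 1 f d <-> h^-1 *: (f (t + h) - f t) @[h --> 0^'] --> d.
Proof.
have -> : (fun h => h^-1 *: (f (t + h) - f t)) =
   (fun h => h^-1 *: ((f \o shift t) (h *: 1) - f t)).
  by apply/funext => h /=; rewrite [h *: 1]mulr1 [t + h]addrC.
split=> [[df <-]|H]; first exact: df.
by apply: DeriveDef; [apply: cvgP H|exact: cvg_lim H].
Qed.

Lemma cderive_cvgP (u : R -> R[i]) (t : R) (d : R[i]) :
  cderive u t d <-> (h%:C)^-1 * (u (t + h) - u t) @[h --> 0^'] --> d.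
Proof.
rewrite cvg_complexP /cderive !is_derive_cvgP.
have E (h : R) (x : R[i]) : (h%:C)^-1 * x = (h^-1 * Re x) +i* (h^-1 * Im x).
  rewrite -fmorphV; apply: complex_eq; rewrite !(ReM, ImM) /=; ring.
have -> : (fun h : R => Re ((h%:C)^-1 * (u (t + h) - u t))) =
  fun h => h^-1 *: (Re (u (t + h)) - Re (u t)).
  by apply/funext => h; rewrite E /= ReD ReN.
have -> : (fun h : R => Im ((h%:C)^-1 * (u (t + h) - u t))) =
  fun h => h^-1 *: (Im (u (t + h)) - Im (u t)).
  by apply/funext => h; rewrite E /= ImD ImN.
by [].
Qed.

Lemma is_vderiveP (n : nat) (u : R -> 'cV[R[i]]_n) (t : R) (d : 'cV[R[i]]_n) :
  is_vderive u t d <-> forall k, cderive (fun x => u x k 0) t (d k 0).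
Proof.
rewrite /is_vderive cvg_cVP.
have E k : (fun h : R => ((h%:C)^-1 *: (u (t + h) - u t)) k 0) =
  (fun h => (h%:C)^-1 * (u (t + h) k 0 - u t k 0)).
  by apply/funext => h; rewrite !mxE.
split=> H k.
  by apply/(cderive_cvgP (fun x => u x k 0)); rewrite -E; exact: H.
by rewrite E; apply/(cderive_cvgP (fun x => u x k 0)); exact: H.
Qed.

Lemma cderive_cst (c : R[i]) t : cderive (fun=> c) t 0.
Proof. by split; exact: is_derive_cst. Qed.

Lemma cderiveD u v t du dv : cderive u t du -> cderive v t dv ->
  cderive (fun x => u x + v x) t (du + dv).
Proof.
move=> [u1 u2] [v1 v2]; split.
  under eq_fun do rewrite ReD.
  by rewrite ReD; exact: is_deriveD.
under eq_fun do rewrite ImD.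
by rewrite ImD; exact: is_deriveD.
Qed.

Lemma is_derive_mulr (f g : R -> R) (t df dg : R) :
  is_derive t 1 f df -> is_derive t 1 g dg ->
  is_derive t 1 (fun x => f x * g x) (df * g t + f t * dg).
Proof.
move=> hf hg; have H := is_deriveM hf hg.
by apply: (is_derive_eq H); rewrite /GRing.scale /=; ring.
Qed.

Lemma cderiveM u v t du dv : cderive u t du -> cderive v t dv ->
  cderive (fun x => u x * v x) t (du * v t + u t * dv).
Proof.
move=> [u1 u2] [v1 v2]; split.
  under eq_fun do rewrite ReM.
  have H := is_deriveB (is_derive_mulr u1 v1) (is_derive_mulr u2 v2).
  by apply: (is_derive_eq H); rewrite !(ReD, ReM); ring.
under eq_fun do rewrite ImM.
have H := is_deriveD (is_derive_mulr u1 v2) (is_derive_mulr u2 v1).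
by apply: (is_derive_eq H); rewrite !(ImD, ImM); ring.
Qed.

Lemma cderiveZ (c : R[i]) u t du : cderive u t du ->
  cderive (fun x => c * u x) t (c * du).
Proof.
by move=> hu; have := cderiveM (cderive_cst c t) hu; rewrite mul0r add0r.
Qed.

Lemma cderiveB u v t du dv : cderive u t du -> cderive v t dv ->
  cderive (fun x => u x - v x) t (du - dv).
Proof.
move=> hu hv; rewrite -[- dv]mulN1r; under eq_fun do rewrite -mulN1r.
by apply: cderiveD => //; exact: cderiveZ.
Qed.

Lemma cderive_sum (I : Type) (s : seq I) (u : I -> R -> R[i]) t (d : I -> R[i]) :
  (forall k, cderive (u k) t (d k)) ->
  cderive (fun x => \sum_(k <- s) u k x) t (\sum_(k <- s) d k).
Proof.
move=> H; elim: s => [|k s IH].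
  by under eq_fun do rewrite big_nil; rewrite big_nil; exact: cderive_cst.
by under eq_fun do rewrite big_cons; rewrite big_cons; exact: cderiveD.
Qed.

Lemma cderive_real t : cderive (fun x => x%:C) t 1.
Proof. by split; [exact: is_derive_id|exact: is_derive_cst]. Qed.

Lemma cderive_horner (p : {poly R[i]}) t :
  cderive (fun x => p.[x%:C]) t (p^`()).[t%:C].
Proof.
elim/poly_ind: p => [|p c IH].
  by under eq_fun do rewrite horner0; rewrite deriv0 horner0; exact: cderive_cst.
under eq_fun do rewrite hornerMXaddC.
rewrite derivMXaddC hornerD hornerMX [_ + _ * _]addrC -[X in cderive _ _ X]addr0.
apply: cderiveD; last exact: cderive_cst.
by rewrite -[X in _ * _ + X]mulr1; apply: cderiveM => //; exact: cderive_real.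
Qed.

Lemma cderive_cexp (l : R[i]) t :
  cderive (fun x => cexp (l * x%:C)) t (l * cexp (l * t%:C)).
Proof.
case: l => a b.
have dl c : is_derive t 1 (fun x : R => c * x) c.
  have H := is_derive_mulr (is_derive_cst c t 1) (is_derive_id t 1).
  by apply: (is_derive_eq H) => /=; ring.
have de : is_derive t 1 (fun x : R => expR (a * x)) (a * expR (a * t)).
  have H := is_derive1_comp (is_derive_expR (a * t)) (dl a).
  apply: (is_derive_eq H).
  by rewrite /= mulrC.
have dc : is_derive t 1 (fun x : R => cos (b * x)) (- b * sin (b * t)).
  have H := is_derive1_comp (is_derive_cos (b * t)) (dl b).
  apply: (is_derive_eq H).
  by rewrite /= mulrC mulrN mulNr.
have ds : is_derive t 1 (fun x : R => sin (b * x)) (b * cos (b * t)).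
  have H := is_derive1_comp (is_derive_sin (b * t)) (dl b).
  apply: (is_derive_eq H).
  by rewrite /= mulrC.
have E x : cexp ((a +i* b) * x%:C) =
    (expR (a * x) * cos (b * x)) +i* (expR (a * x) * sin (b * x)).
  rewrite /cexp ReM ImM /= !mulr0 subr0 add0r.
  by apply: complex_eq; rewrite !(ReM, ImM) /=; ring.
rewrite E; split.
  under eq_fun do rewrite E /=.
  apply: (is_derive_eq (is_derive_mulr de dc)).
  by rewrite ReM /=; ring.
under eq_fun do rewrite E /=.
apply: (is_derive_eq (is_derive_mulr de ds)).
by rewrite ImM /=; ring.
Qed.

End ComplexDerivative.

(** * Mean value estimates for real functions with exponentially bounded derivative *)

Section Increments.
Variable R : realType.

Lemma is_derive_le0_nincr (f df : R -> R) (T : R) :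
  (forall t, T <= t -> is_derive t 1 f (df t)) ->
  (forall t, T <= t -> df t <= 0) ->
  forall s t, T <= s -> s <= t -> f t <= f s.
Proof.
move=> dfP df0 s t Ts st.
have [x xst||c cst fE] := @MVT_segment R f df s t st.
- by apply: dfP; rewrite (le_trans Ts)// ltW// (itvP xst).
- apply: derivable_within_continuous => x xst.
  have /dfP [] // : T <= x by rewrite (le_trans Ts)// (itvP xst).
rewrite -subr_le0 fE mulr_le0_ge0 ?subr_ge0//.
by rewrite df0// (le_trans Ts)// (itvP cst).
Qed.

Variables (T K k : R).
Hypothesis k0 : k != 0.

(** An antiderivative of - K exp(- k t); for k > 0 it is the integral of K exp(- k s) over s >= t.
    For k < 0 only its increments are used. *)
Let phi (t : R) : R := K / k * expR (- k * t).

Let dphi (t : R) : is_derive t 1 phi (- K * expR (- k * t)).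
Proof.
have dl : is_derive t 1 (fun x : R => - k * x) (- k).
  have H := is_derive_mulr (is_derive_cst (- k) t 1) (is_derive_id t 1).
  by apply: (is_derive_eq H) => /=; ring.
have H := is_derive_mulr (is_derive_cst (K / k) t 1)
  (is_derive1_comp (is_derive_expR (- k * t)) dl).
by apply: (is_derive_eq H) => /=; field.
Qed.

(** Both [phi + w] and [phi - w] have nonpositive derivative, hence are nonincreasing. *)
Lemma increment_le_exp (w dw : R -> R) :
  (forall t, T <= t -> is_derive t 1 w (dw t)) ->
  (forall t, T <= t -> `|dw t| <= K * expR (- k * t)) ->
  forall s t, T <= s -> s <= t -> `|w t - w s| <= phi s - phi t.
Proof.
move=> wP dwK s t Ts st; rewrite ler_norml.
have dD x : T <= x -> is_derive x 1 (phi + w) (- K * expR (- k * x) + dw x).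
  by move=> /wP ?; apply: is_deriveD; exact: dphi.
have dB x : T <= x -> is_derive x 1 (phi - w) (- K * expR (- k * x) - dw x).
  by move=> /wP ?; apply: is_deriveB; exact: dphi.
have hD : phi t + w t <= phi s + w s.
  apply: (is_derive_le0_nincr dD _ Ts st) => x /dwK.
  by rewrite ler_norml => /andP[]; lra.
have hB : phi t - w t <= phi s - w s.
  apply: (is_derive_le0_nincr dB _ Ts st) => x /dwK.
  by rewrite ler_norml => /andP[]; lra.
by apply/andP; split; lra.
Qed.

Lemma exp_increment_limit (w dw : R -> R) : 0 < k ->
  (forall t, T <= t -> is_derive t 1 w (dw t)) ->
  (forall t, T <= t -> `|dw t| <= K * expR (- k * t)) ->
  exists c, forall t, T <= t -> `|w t - c| <= phi t.
Proof.
move=> kp wP dwK; have inc := increment_le_exp wP dwK.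
have K0 : 0 <= K.
  have := dwK _ (lexx T); rewrite -(pmulr_lge0 _ (expR_gt0 (- k * T))).
  exact: le_trans.
have phi0 t : 0 <= phi t by rewrite /phi mulr_ge0 ?expR_ge0// divr_ge0// ltW.
(* Lower and upper bounds for the future limit are compatible whichever of [s] and [t] comes
   first. *)
have cross s t : T <= s -> T <= t -> w s - phi s <= w t + phi t.
  move=> Ts Tt; have ps := phi0 s; have pt := phi0 t.
  have [st|/ltW ts] := leP s t.
    by have := inc _ _ Ts st; rewrite ler_norml => /andP[]; lra.
  by have := inc _ _ Tt ts; rewrite ler_norml => /andP[]; lra.
(* w - phi is nondecreasing and w + phi is nonincreasing, so the limit of w is
   the supremum of w - phi. *)
pose E := [set w t - phi t | t in [set t | T <= t]].
have ubE t : T <= t -> ubound E (w t + phi t).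
  by move=> Tt _ [s /= Ts <-]; exact: cross.
have E0 : E !=set0 by exists (w T - phi T), T => /=.
exists (sup E) => t Tt; rewrite ler_distl; apply/andP; split.
  by rewrite lerBlDr; apply: ge_sup => //; exact: ubE.
rewrite -lerBlDr; apply: ub_le_sup; last by exists t.
by exists (w t + phi t); exact: ubE.
Qed.

End Increments.

(** * The same estimates for complex-valued functions *)

Section ComplexIncrements.
Variables (R : realType) (T K k : R) (w dw : R -> R[i]).
Hypothesis wP : forall t, T <= t -> cderive w t (dw t).
Hypothesis dwK : forall t, T <= t -> normc (dw t) <= K * expR (- k * t).

Let wR t (Tt : T <= t) := (wP Tt).1.
Let wI t (Tt : T <= t) := (wP Tt).2.
Let dwR t : T <= t -> `|Re (dw t)| <= K * expR (- k * t).
Proof. by move=> Tt; apply: le_trans (Re_le_normc _) (dwK Tt). Qed.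
Let dwI t : T <= t -> `|Im (dw t)| <= K * expR (- k * t).
Proof. by move=> Tt; apply: le_trans (Im_le_normc _) (dwK Tt). Qed.

(** The factor 2 comes from adding the bounds for the real and imaginary parts. *)
Lemma cderive_decay_limit : 0 < k ->
  exists c, forall t, T <= t -> normc (w t - c) <= 2 * (K / k) * expR (- k * t).
Proof.
move=> kp; have k0 : k != 0 by rewrite gt_eqF.
have [cr hr] := exp_increment_limit k0 kp wR dwR.
have [ci hi] := exp_increment_limit k0 kp wI dwI.
exists (cr +i* ci) => t Tt; apply: le_trans (normc_le_ReIm _) _.
rewrite ReD ImD ReN ImN /=.
by have := hr _ Tt; have := hi _ Tt; lra.
Qed.

Lemma cderive_growth : k < 0 ->
  exists C, forall t, T <= t -> normc (w t) <= C * expR (- k * t).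
Proof.
move=> kn; have k0 : k != 0 by rewrite lt_eqF.
(* As k < 0, exp(- k t) is at least exp(- k T), so the first summand absorbs the initial value; the
   second bounds the increments of both parts, since [phi T - phi t] is at most K / (- k) exp(- k
   t). *)
exists (normc (w T) / expR (- k * T) + 2 * (K / - k)) => t Tt.
have hr := increment_le_exp k0 wR dwR (lexx T) Tt.
have hi := increment_le_exp k0 wI dwI (lexx T) Tt.
have K0 : 0 <= K / - k.
  rewrite divr_ge0 ?oppr_ge0 ?(ltW kn)//.
  have := dwK (lexx T); rewrite -(pmulr_lge0 _ (expR_gt0 (- k * T))).
  by apply: le_trans; exact: normc_ge0.
have h1 : normc (w t) <= normc (w T) + 2 * (K / - k) * expR (- k * t).
  rewrite -[w t](subrK (w T)) addrC; apply: le_trans (le_normcD _ _) _.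
  rewrite lerD2l; apply: le_trans (normc_le_ReIm _) _; rewrite ReD ImD ReN ImN.
  have : 0 <= K / - k * expR (- k * T) by rewrite mulr_ge0 ?expR_ge0.
  by move: hr hi; rewrite invrN mulrN; lra.
apply: le_trans h1 _; rewrite [leRHS]mulrDl lerD2r -mulrA ler_peMr ?normc_ge0//.
rewrite mulrC -expRN -expRD -[leLHS]expR0 ler_expR.
by rewrite !mulNr opprK addrC subr_ge0 ler_wnM2l ?(ltW kn).
Qed.

End ComplexIncrements.

(** * Scalar functions of exponential order *)

Section Decay.
Variable R : realType.
Implicit Types (u v : R -> R[i]) (r : R).

(** No sign is imposed on [T] and [C]; [decays_bigO_infty] makes them positive. *)
Definition decays r u := exists T C : R,
  forall t, T <= t -> normc (u t) <= C * expR (- r * t).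

Lemma decaysD r u v : decays r u -> decays r v -> decays r (fun t => u t + v t).
Proof.
move=> [T1 [C1 h1]] [T2 [C2 h2]]; exists (Num.max T1 T2), (C1 + C2) => t.
rewrite ge_max => /andP[/h1 ? /h2 ?]; apply: le_trans (le_normcD _ _) _.
by rewrite mulrDl lerD.
Qed.

Lemma decaysZ r c u : decays r u -> decays r (fun t => c * u t).
Proof.
move=> [T [C h]]; exists T, (normc c * C) => t /h ?.
by rewrite Normc.normcM -mulrA ler_wpM2l ?normc_ge0.
Qed.

Lemma decays0 r : decays r (fun=> 0).
Proof. by exists 0, 0 => t _; rewrite mul0r Normc.normc0. Qed.

Lemma decays_sum (I : Type) (s : seq I) (P : pred I) r (u : I -> R -> R[i]) :
  (forall i, P i -> decays r (u i)) -> decays r (fun t => \sum_(i <- s | P i) u i t).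
Proof.
move=> h; elim: s => [|i s IH].
  by under eq_fun do rewrite big_nil; exact: decays0.
under eq_fun do rewrite big_cons.
by case Pi: (P i) => //; apply: decaysD => //; exact: h.
Qed.

Lemma decaysW r r' u : r' <= r -> decays r u -> decays r' u.
Proof.
move=> rr [T [C h]]; exists (Num.max 0 T), C => t.
(* Lowering the rate enlarges the exponential only for t >= 0, hence the maximum with 0; the sign of
   [C] is read off the bound itself. *)
rewrite ge_max => /andP[t0 /h ut]; apply: le_trans (ut) _.
have C0 : 0 <= C.
  rewrite -(pmulr_lge0 _ (expR_gt0 (- r * t))).
  by apply: le_trans ut; exact: normc_ge0.
by rewrite ler_wpM2l// ler_expR ler_wpM2r// lerN2.
Qed.

End Decay.

(** * Sums of polynomials times exponentials, and the unperturbed scalar equation *)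

Section QuasiPolynomials.
Variable R : realType.
Implicit Types (m : R) (u v : R -> R[i]) (p : {poly R[i]}).

Lemma poly_le_exp p (k : R) : 0 < k ->
  exists C, forall t : R, 0 <= t -> normc p.[t%:C] <= C * expR (k * t).
Proof.
elim/poly_ind: p k => [|p c IH] k k0.
  by exists 0 => t _; rewrite horner0 Normc.normc0 mul0r.
have k20 : 0 < k / 2 by rewrite divr_gt0.
(* The rate is shared: exp(k t / 2) controls [p], and t <= (2 / k) exp(k t / 2) controls the extra
   factor t. *)
have [C hC] := IH _ k20; exists (C * (2 / k) + normc c) => t t0.
rewrite hornerMXaddC; apply: le_trans (le_normcD _ _) _; rewrite mulrDl lerD//.
  have -> : expR (k * t) = expR (k / 2 * t) * expR (k / 2 * t).
    by rewrite -expRD; congr expR; field.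
  rewrite Normc.normcM mulrACA ler_pM ?normc_ge0 ?hC//.
  rewrite /= expr0n/= addr0 sqrtr_sqr ger0_norm//.
  have k1 : k / 2 * (2 / k) = 1 by field; rewrite gt_eqF.
  rewrite -(ler_pM2l k20) [leRHS]mulrA k1.
  by have := expR_ge1Dx (k / 2 * t); lra.
by rewrite ler_peMr ?normc_ge0// -[leLHS]expR0 ler_expR mulr_ge0// ltW.
Qed.

(* Repeated exponents are allowed, which makes sums mere concatenations. *)
Definition quasipoly m u := exists2 s : seq (R[i] * {poly R[i]}),
  (forall x, x \in s -> Re x.1 = m) &
  forall t, u t = \sum_(x <- s) cexp (x.1 * t%:C) * x.2.[t%:C].

Lemma quasipoly0 m : quasipoly m (fun=> 0).
Proof. by exists [::] => // t; rewrite big_nil. Qed.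

Lemma quasipoly_term m l p : Re l = m ->
  quasipoly m (fun t => cexp (l * t%:C) * p.[t%:C]).
Proof.
move=> lm; exists [:: (l, p)] => [x|t]; last by rewrite big_seq1.
by rewrite inE => /eqP->.
Qed.

Lemma quasipolyD m u v : quasipoly m u -> quasipoly m v ->
  quasipoly m (fun t => u t + v t).
Proof.
move=> [s1 h1 e1] [s2 h2 e2]; exists (s1 ++ s2) => [x|t].
  by rewrite mem_cat => /orP[/h1|/h2].
by rewrite big_cat /= e1 e2.
Qed.

Lemma quasipolyZ m c u : quasipoly m u -> quasipoly m (fun t => c * u t).
Proof.
move=> [s h e]; exists [seq (x.1, c *: x.2) | x <- s] => [_ /mapP[x /h xm ->]//|t].
rewrite big_map e mulr_sumr; apply: eq_bigr => x _ /=.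
by rewrite hornerZ mulrCA.
Qed.

Lemma quasipoly_sum (I : Type) (s : seq I) (P : pred I) m (u : I -> R -> R[i]) :
  (forall i, P i -> quasipoly m (u i)) ->
  quasipoly m (fun t => \sum_(i <- s | P i) u i t).
Proof.
move=> h; elim: s => [|i s IH].
  by under eq_fun do rewrite big_nil; exact: quasipoly0.
under eq_fun do rewrite big_cons.
by case Pi: (P i) => //; apply: quasipolyD => //; exact: h.
Qed.

Lemma quasipoly_ind m (P : (R -> R[i]) -> Prop) :
  P (fun=> 0) ->
  (forall l p u, Re l = m -> P u ->
     P (fun t => cexp (l * t%:C) * p.[t%:C] + u t)) ->
  forall u, quasipoly m u -> P u.
Proof.
move=> P0 PD u [s h /funext->]; elim: s h => [|[l p] s IH] h.
  by under eq_fun do rewrite big_nil.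
under eq_fun do rewrite big_cons /=; apply: PD.
  by apply: (h (l, p)); rewrite mem_head.
by apply: IH => x xs; apply: h; rewrite inE xs orbT.
Qed.

(** In each term the polynomial is absorbed by exp((m - r) t), whose rate is positive. *)
Lemma quasipoly_decays m u r : quasipoly (- m) u -> r < m -> decays r u.
Proof.
move=> + rm; elim/quasipoly_ind: u /; first exact: decays0.
move=> l p u lm uP; apply: decaysD => //.
have [|C hC] := @poly_le_exp p (m - r); first by rewrite subr_gt0.
exists 0, C => t t0; rewrite Normc.normcM normc_cexp.
have -> : - r * t = - m * t + (m - r) * t by ring.
rewrite expRD mulrCA ReM /= mulr0 subr0 lm ler_wpM2l ?expR_ge0//.
exact: hC.
Qed.

Lemma poly_antiderivative p : exists q : {poly R[i]}, q^`() = p.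
Proof.
(* At i = 0 the quotient by 0 is 0, a harmless choice of the constant of integration. *)
exists (\poly_(i < (size p).+1) (p`_i.-1 / i%:R)); apply/polyP => i.
rewrite coef_deriv coef_poly ltnS /=.
case: ltnP => ip; first by rewrite -[LHS]mulr_natr divfK// pnatr_eq0.
by rewrite mul0rn nth_default.
Qed.

Lemma poly_ode (c : R[i]) p : exists q : {poly R[i]}, q^`() + c *: q = p.
Proof.
(* The resonant case, where the degree may rise, is plain integration. *)
have [->|c0] := eqVneq c 0.
  by have [q <-] := poly_antiderivative p; exists q; rewrite scale0r addr0.
elim: {p}(size p) {-2}p (leqnn (size p)) => [|n IH] p.
  by rewrite leqn0 size_poly_eq0 => /eqP->; exists 0; rewrite deriv0 scaler0 addr0.
(* q := c^-1 p solves the equation up to c^-1 p', of smaller degree. *)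
move=> pn; have [|q qE] := IH (- (c^-1 *: p^`())).
  rewrite size_polyN (leq_trans (size_scale_leq _ _))//.
  have [->|p0] := eqVneq p 0; first by rewrite deriv0 size_poly0.
  by rewrite -ltnS (leq_trans (lt_size_deriv p0)).
exists (c^-1 *: p + q); rewrite derivD derivZ scalerDr scalerA divff// scale1r.
by rewrite addrACA qE addrAC subrr add0r.
Qed.

(** By linearity one term at a time; each term keeps its exponent, so the solution stays in the same
    class. *)
Lemma quasipoly_ode (a : R[i]) m f : quasipoly m f ->
  exists2 z, quasipoly m z & forall t, cderive z t (f t - a * z t).
Proof.
elim/quasipoly_ind: f /.
  exists (fun=> 0) => [|t]; first exact: quasipoly0.
  by rewrite mulr0 subr0; exact: cderive_cst.
move=> l p u lm [z zq zP].
have [q qE] := poly_ode (a + l) p.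
exists (fun t => cexp (l * t%:C) * q.[t%:C] + z t) => [|t].
  by apply: quasipolyD => //; exact: quasipoly_term.
have := cderiveD (cderiveM (cderive_cexp l t) (cderive_horner q t)) (zP t).
congr cderive; rewrite -qE hornerD hornerZ; ring.
Qed.

End QuasiPolynomials.

(** * Asymptotics for the perturbed scalar equation *)

Section ScalarEquation.
Variable R : realType.

Lemma expR_decay_cvg0 (k : R) : 0 < k -> expR (- k * t) @[t --> +oo] --> 0.
Proof.
move=> k0; under eq_fun do rewrite mulNr.
exact: (cvg_comp _ (fun x => expR (- x)) (gt0_cvgMry k0 cvg_id) (@cvgr_expR R)).
Qed.

(** The product exp(a t) (y - z) tends to c, but exp(a t) y tends to 0 by assumption and exp(a t) z
    does because z decays faster than exp(- Re a t). *)
Lemma integrating_factor_eq0 (a c : R[i]) (r k C D : R) (y z : R -> R[i]) T :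
  Re a < r -> 0 < k ->
  expR (Re a * t) * normc (y t) @[t --> +oo] --> 0 ->
  (forall t, T <= t -> normc (z t) <= C * expR (- r * t)) ->
  (forall t, T <= t ->
     normc (cexp (a * t%:C) * (y t - z t) - c) <= D * expR (- k * t)) ->
  c = 0.
Proof.
move=> ar k0 ylim zC wD.
(* This sum bounds the constant |c| for all large t. *)
have h0 : expR (Re a * t) * normc (y t) + C * expR (- (r - Re a) * t) +
    D * expR (- k * t) @[t --> +oo] --> 0.
  have -> : 0 = 0 + C * 0 + D * 0 :> R by ring.
  apply: cvgD; first apply: cvgD => //.
    by apply: cvgMl_tmp; apply: expR_decay_cvg0; rewrite subr_gt0.
  by apply: cvgMl_tmp; exact: expR_decay_cvg0.
apply: Normc.eq0_normc; apply/eqP; rewrite eq_le normc_ge0 andbT.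
rewrite -(cvg_lim _ h0)//; apply: limr_ge; first by apply: cvgP h0.
near=> t; have Tt : T <= t by near: t; apply: nbhs_pinfty_ge; exact: num_real.
pose w := cexp (a * t%:C) * (y t - z t).
have -> : c = w - (w - c) by rewrite opprB addrC subrK.
apply: le_trans (le_normcD _ _) _; rewrite normcN lerD ?wD//.
rewrite /w Normc.normcM normc_cexp ReM /= mulr0 subr0.
apply: (@le_trans _ _ (expR (Re a * t) * (normc (y t) + C * expR (- r * t)))).
  rewrite ler_wpM2l ?expR_ge0//; apply: le_trans (le_normcD _ _) _.
  by rewrite normcN lerD2l zC.
rewrite mulrDr lerD2l mulrCA -expRD.
by have -> : Re a * t + - r * t = - (r - Re a) * t by ring.
Unshelve. all: by end_near. Qed.

Lemma scalar_asymptotics (a : R[i]) (mu delta T : R) (f g y : R -> R[i]) :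
  0 < delta -> quasipoly (- mu) f -> decays (mu + delta) g ->
  (forall t, T < t -> cderive y t (f t + g t - a * y t)) ->
  (Re a < mu -> expR (Re a * t) * normc (y t) @[t --> +oo] --> 0) ->
  exists z, [/\ quasipoly (- mu) z,
    forall t, cderive z t (f t - a * z t) &
    exists2 eps, 0 < eps & decays (mu + eps) (fun t => y t - z t)].
Proof.
move=> delta0 fq gdec yP ylim.
have [z0 z0q z0P] := quasipoly_ode a fq.
pose w t := cexp (a * t%:C) * (y t - z0 t).
have wP t : T < t -> cderive w t (cexp (a * t%:C) * g t).
  move=> Tt; have := cderiveM (cderive_cexp a t) (cderiveB (yP _ Tt) (z0P t)).
  congr cderive; ring.
have yzE t : y t - z0 t = cexp (- a * t%:C) * w t.
  by rewrite mulrA -cexpD mulNr addNr cexp0 mul1r.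
have expE (r t : R) : expR (Re a * t) * expR (- r * t) = expR (- (r - Re a) * t).
  by rewrite -expRD; congr expR; ring.
have normE t : normc (cexp (a * t%:C)) = expR (Re a * t).
  by rewrite normc_cexp ReM /= mulr0 subr0.
have normNE t : normc (cexp (- a * t%:C)) = expR (- Re a * t).
  by rewrite normc_cexp ReM /= mulr0 subr0 ReN.
(* The equation holds for t > T only, while the increment estimates start on a closed half-line:
   hence the threshold T + 1. *)
have dwK r S C : (forall t, S <= t -> normc (g t) <= C * expR (- r * t)) ->
    forall t, Num.max (T + 1) S <= t ->
    normc (cexp (a * t%:C) * g t) <= C * expR (- (r - Re a) * t).
  move=> gS t; rewrite ge_max => /andP[_ /gS gt].
  by rewrite Normc.normcM normE -expE mulrCA ler_wpM2l ?expR_ge0.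
have wP' S t : Num.max (T + 1) S <= t -> cderive w t (cexp (a * t%:C) * g t).
  by rewrite ge_max => /andP[Tt _]; apply: wP; lra.
have [amu|mua] := leP (Re a) mu.
  have [S [C /dwK gS]] := gdec.
  have k0 : 0 < mu + delta - Re a by lra.
  have [c wc] := cderive_decay_limit (wP' S) gS k0.
  exists (fun t => z0 t + c * cexp (- a * t%:C)); split.
  - apply: quasipolyD => //.
    have [alt|aeq] := ltP (Re a) mu.
      suff -> : c = 0 by under eq_fun do rewrite mul0r; exact: quasipoly0.
      (* The midpoint is a rate below mu, at which [z0] decays, and still above Re a. *)
      have [|S' [C' z0C]] := @quasipoly_decays R mu z0 ((Re a + mu) / 2) z0q.
        by lra.
      apply: (@integrating_factor_eq0 a c ((Re a + mu) / 2)
        (mu + delta - Re a) C' (2 * (C / (mu + delta - Re a))) y z0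
        (Num.max (Num.max (T + 1) S) S')) => //; first by lra.
      - exact: ylim.
      - by move=> t; rewrite ge_max => /andP[_ /z0C].
      - by move=> t; rewrite ge_max => /andP[/wc].
    (* Here Re a = mu, so c exp(- a t) is itself a term with exponent of real part - mu. *)
    have -> : (fun t => c * cexp (- a * t%:C)) =
        (fun t => cexp (- a * t%:C) * c%:P.[t%:C]).
      by apply/funext => t; rewrite hornerC mulrC.
    apply: quasipoly_term; rewrite ReN; congr (- _).
    by apply/eqP; rewrite eq_le amu aeq.
  - move=> t; have := cderiveD (z0P t) (cderiveZ c (cderive_cexp (- a) t)).
    congr cderive; ring.
  exists delta => //; exists (Num.max (T + 1) S), (2 * (C / (mu + delta - Re a))).
  move=> t /wc wct; rewrite opprD addrA yzE [c * _]mulrC -mulrBr.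
  rewrite Normc.normcM normNE.
  have -> : - (mu + delta) * t = - Re a * t + - (mu + delta - Re a) * t by ring.
  by rewrite expRD mulrCA ler_wpM2l ?expR_ge0.
(* Half the gap keeps mu + eps below Re a, which is the growth case. *)
pose eps := Num.min delta ((Re a - mu) / 2).
have eps0 : 0 < eps by rewrite lt_min delta0 /=; lra.
exists z0; split=> //; exists eps => //.
have [|S [C /dwK gS]] := @decaysW R (mu + delta) (mu + eps) g _ gdec.
  by rewrite lerD2l ge_min lexx.
have k0 : mu + eps - Re a < 0.
  have : eps <= (Re a - mu) / 2 by rewrite ge_min lexx orbT.
  by lra.
have [D wD] := cderive_growth (wP' S) gS k0.
exists (Num.max (T + 1) S), D => t /wD wDt; rewrite yzE Normc.normcM normNE.
have -> : - (mu + eps) * t = - Re a * t + - (mu + eps - Re a) * t by ring.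
by rewrite expRD mulrCA ler_wpM2l ?expR_ge0.
Qed.

End ScalarEquation.

(** * Triangular systems, row by row *)

Section TriangularSystem.
Variables (R : realType) (n : nat).

Lemma triangular_asymptotics (L : 'M[R[i]]_n) (mu delta T : R)
    (f g y : 'I_n -> R -> R[i]) :
  is_trig_mx L -> 0 < delta ->
  (forall k, quasipoly (- mu) (f k)) -> (forall k, decays (mu + delta) (g k)) ->
  (forall k t, T < t -> cderive (y k) t (f k t + g k t - \sum_j L k j * y j t)) ->
  (forall k, Re (L k k) < mu ->
     expR (Re (L k k) * t) * normc (y k t) @[t --> +oo] --> 0) ->
  exists z : 'I_n -> R -> R[i], exists2 eps, 0 < eps &
    forall k, [/\ quasipoly (- mu) (z k),
      forall t, cderive (z k) t (f k t - \sum_j L k j * z j t) &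
      decays (mu + eps) (fun t => y k t - z k t)].
Proof.
move=> /is_trig_mxP Ltrig delta0 fq gdec yP ylim.
have sumE (k : 'I_n) (F : 'I_n -> R[i]) :
    \sum_j L k j * F j = L k k * F k + \sum_(j < n | (j < k)%N) L k j * F j.
  rewrite (bigD1 k)//=; congr (_ + _).
  rewrite big_mkcond [RHS]big_mkcond; apply: eq_bigr => j _.
  by rewrite -val_eqE /=; case: (ltngtP j k) => // kj; rewrite Ltrig ?mul0r.
suff /(_ n (leqnn n)) [z [eps eps0 zP]] : forall m, (m <= n)%N ->
    exists z : 'I_n -> R -> R[i], exists2 eps, 0 < eps &
    forall k : 'I_n, (k < m)%N -> [/\ quasipoly (- mu) (z k),
      forall t, cderive (z k) t (f k t - \sum_j L k j * z j t) &
      decays (mu + eps) (fun t => y k t - z k t)].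
  by exists z, eps => // k; exact: zP.
(* The first m rows only involve each other. *)
elim=> [_|m IH mn]; first by exists (fun _ _ => 0), 1.
have [z [eps eps0 zP]] := IH (ltnW mn); pose k := Ordinal mn.
(* Each earlier [y j] is split as [z j] plus a remainder: the first part joins the forcing, the
   second the perturbation. The remainders have rate mu + eps, hence the minimum of [delta] and
   [eps]. *)
have [//|||||zk [zkq zkP [e e0 zke]]] := @scalar_asymptotics R (L k k) mu
    (Num.min delta eps) T
    (fun t => f k t + -1 * \sum_(j < n | (j < k)%N) L k j * z j t)
    (fun t => g k t + -1 * \sum_(j < n | (j < k)%N) L k j * (y j t - z j t))
    (y k).
- by rewrite lt_min delta0.
- apply: quasipolyD => //; apply/quasipolyZ/quasipoly_sum => j jk.
  by apply: quasipolyZ; have [] := zP j jk.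
- apply: decaysD.
    by apply: decaysW (gdec k); rewrite lerD2l ge_min lexx.
  apply/decaysZ/decays_sum => j jk; apply: decaysZ; have [_ _] := zP j jk.
  by apply: decaysW; rewrite lerD2l ge_min lexx orbT.
- move=> t Tt; have := yP k t Tt; congr cderive; rewrite sumE.
  under [X in _ = _ + (_ + _ * X) - _]eq_bigr do rewrite mulrBr.
  by rewrite sumrB; ring.
- exact: ylim.
exists (fun j => if j == k then zk else z j), (Num.min eps e).
  by rewrite lt_min eps0.
move=> j; rewrite ltnS => jm.
(* Redefining the function at index [k], which is m, is invisible in the off-diagonal sums of rows
   up to m. *)
have sumzE (i : 'I_n) t : (i <= m)%N ->
    \sum_(j < n | (j < i)%N) L i j * (if j == k then zk else z j) t =
    \sum_(j < n | (j < i)%N) L i j * z j t.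
  move=> im; apply: eq_bigr => l li; case: eqP => // lk.
  by move: li; rewrite lk /= ltnNge im.
have [jk|jk] := eqVneq j k.
  rewrite jk; split=> // [t|].
    have := zkP t; congr cderive; rewrite sumE eqxx sumzE//.
    by ring.
  by apply: decaysW zke; rewrite lerD2l ge_min lexx orbT.
have {}jm : (j < m)%N by rewrite ltn_neqAle jm andbT -(inj_eq val_inj) in jk *.
have [zq zd zdec] := zP j jm; split=> // [t|].
  have := zd t; congr cderive; rewrite !sumE sumzE ?(ltnW jm)//.
  by rewrite (negPf jk).
by apply: decaysW zdec; rewrite lerD2l ge_min lexx.
Qed.

End TriangularSystem.

(** * Reduction of the matrix to triangular form *)

Section Triangularization.
Variable R : realType.

Lemma complex_trigonalization (n : nat) (A : 'M[R[i]]_n) :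
  exists P L : 'M[R[i]]_n, [/\ P \in unitmx, is_trig_mx L & P *m A = L *m P].
Proof.
(* [Schur] requires positive dimension. *)
case: n A => [|n] A.
  exists 1%:M, A; split; [exact: unitmx1|by apply/is_trig_mxP => -[]|].
  by rewrite mul1mx mulmx1.
have [P /unitarymx_unit Pu trigA] := Schur A (ltn0Sn n).
by exists P, (conjmx P A); split=> //; exact/(similarP Pu)/eqP.
Qed.

(** Makes the growth assumption on y available for each diagonal entry. A row eigenvector v of [L]
    yields the row eigenvector v P of [A]. *)
Lemma eigenvalue_trig_diag (n : nat) (A P L : 'M[R[i]]_n) (k : 'I_n) :
  P \in unitmx -> is_trig_mx L -> P *m A = L *m P -> eigenvalue A (L k k).
Proof.
move=> Pu trigL PA.
have : eigenvalue L (L k k).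
  rewrite eigenvalue_root_char char_poly_trig// rootE horner_prod.
  by rewrite (bigD1 k)//= hornerXsubC subrr mul0r.
move=> /eigenvalueP[v vL v0]; apply/eigenvalueP; exists (v *m P).
  by rewrite -mulmxA PA mulmxA vL scalemxAl.
by apply: contraNneq v0 => vP; rewrite -(mulmxK Pu v) vP mul0mx.
Qed.

End Triangularization.

(** * Passage between vector functions and their coordinates *)

Section VectorFunctions.
Variables (R : realType) (n : nat).

Lemma F_E_coord (m : R) (u : R -> 'cV[R[i]]_n) k :
  F_E m u -> quasipoly m (fun t => u t k 0).
Proof.
move=> [S [p [_ Sm uE]]]; exists [seq (l, p l k 0) | l <- S].
  by move=> _ /mapP[l /Sm lm ->].
by move=> t; rewrite uE summxE big_map; apply: eq_bigr => l _; rewrite !mxE.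
Qed.

Lemma F_E_col (m : R) (u : 'I_n -> R -> R[i]) :
  (forall k, quasipoly m (u k)) -> F_E m (fun t => \col_k u k t).
Proof.
move=> /(_ _)/cid2-/all_sig2[s sm uE].
(* All coordinates must share one duplicate-free list of exponents; polynomials with equal exponent
   are added up, and an exponent absent from a coordinate gets the empty sum. *)
pose S := undup (flatten [seq [seq x.1 | x <- s k] | k <- enum 'I_n]).
exists S, (fun l => \col_k \sum_(x <- s k | x.1 == l) x.2); split.
- exact: undup_uniq.
- by move=> l; rewrite mem_undup => /flatten_mapP[k _ /mapP[x xs ->]]; exact: sm xs.
move=> t; apply/colP => k; rewrite mxE uE summxE.
under [RHS]eq_bigr => l _ do rewrite !mxE horner_sum mulr_sumr.
(* After the exchange, each term [x] meets exactly one exponent of [S], as [S] has no repetition. *)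
rewrite (exchange_big_dep predT)//=; apply: eq_big_seq => x xs.
under [RHS]eq_bigl => l do rewrite eq_sym.
rewrite -big_filter filter_pred1_uniq ?undup_uniq ?big_seq1// mem_undup.
by apply/flatten_mapP; exists k; rewrite ?mem_enum// map_f.
Qed.

Lemma decays_bigO_infty (r : R) (u : R -> 'cV[R[i]]_n) :
  (forall k, decays r (fun t => u t k 0)) ->
  bigO_infty u (fun t => expR (- r * t)).
Proof.
move=> /(_ _)/cid-/all_sig[T] /(_ _)/cid-/all_sig[C uC].
(* Sums of absolute values dominate all the coordinate constants at once; the 1 makes them positive
   even when n = 0. *)
exists (1 + \sum_k `|T k|), (1 + \sum_k `|C k|).
split; try by rewrite ltr_pwDl// sumr_ge0.
move=> t Tt; apply: le_trans (enorm_le _) _.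
rewrite mulrDl mul1r mulr_suml.
apply: (@le_trans _ _ (\sum_k `|C k| * expR (- r * t))).
  apply: ler_sum => k _; apply: le_trans (uC k t _) _.
    apply: le_trans Tt; rewrite (bigD1 k)//= addrCA (le_trans (ler_norm _))//.
    by rewrite lerDl addr_ge0// sumr_ge0.
  by rewrite ler_wpM2r ?expR_ge0// ler_norm.
by rewrite lerDr expR_ge0.
Qed.

Lemma bigO_infty_decays (r : R) (u : R -> 'cV[R[i]]_n) k :
  bigO_infty u (fun t => expR (- r * t)) -> decays r (fun t => u t k 0).
Proof.
move=> [T [C [_ _ uC]]]; exists T, C => t /uC; apply: le_trans.
exact: enorm_ge.
Qed.

Lemma cvg_mulmx_coord (P : 'M[R[i]]_n) (lam : R) (y : R -> 'cV[R[i]]_n) k :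
  t ^+ 1 * expR (lam * t) * enorm (y t) @[t --> +oo] --> 0 ->
  expR (lam * t) * normc ((P *m y t) k 0) @[t --> +oo] --> 0.
Proof.
move=> ylim; pose K := \sum_j normc (P k j).
have Kylim : K * (t ^+ 1 * expR (lam * t) * enorm (y t)) @[t --> +oo] --> 0.
  by rewrite -(mulr0 K); exact: cvgMl_tmp.
apply: squeeze_cvgr (cvg_cst 0) Kylim; near=> t.
have t1 : 1 <= t by near: t; apply: nbhs_pinfty_ge; exact: num_real.
rewrite mulr_ge0 ?expR_ge0 ?normc_ge0//= expr1.
apply: (@le_trans _ _ (expR (lam * t) * (K * enorm (y t)))).
  rewrite ler_wpM2l ?expR_ge0// mxE; apply: le_trans (normc_sum _ _ _) _.
  rewrite mulr_suml ler_sum// => j _.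
  by rewrite Normc.normcM ler_wpM2l ?normc_ge0// enorm_ge.
rewrite mulrCA ler_wpM2l ?sumr_ge0// => [j _|]; first exact: normc_ge0.
by rewrite -mulrA ler_peMl// mulr_ge0 ?expR_ge0// sqrtr_ge0.
Unshelve. all: by end_near. Qed.

Lemma cderive_mulmx (P : 'M[R[i]]_n) (u : R -> 'cV[R[i]]_n)
    (t : R) (d : 'cV[R[i]]_n) k :
  (forall j, cderive (fun x => u x j 0) t (d j 0)) ->
  cderive (fun x => (P *m u x) k 0) t ((P *m d) k 0).
Proof.
move=> H; under eq_fun do rewrite mxE; rewrite mxE.
by apply: cderive_sum => j; exact: cderiveZ.
Qed.

End VectorFunctions.

(** * Change of variables to the triangular system and back *)

Theorem theorem5p1 (R : realType) (n : nat) (A : 'M[R[i]]_n)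
  (hA : forall L : R[i], eigenvalue A L -> 0 < complex.Re L)
  (mu : R) (hmu : 0 < mu)
  (f : R -> 'cV[R[i]]_n) (hf : F_E (- mu) f)
  (T : R) (hT : 0 <= T)
  (g : R -> 'cV[R[i]]_n) (hgc : {within `[T, +oo[, continuous g})
  (hg : exists2 delta : R, 0 < delta &
     bigO_infty g (fun t => expR (- (mu + delta) * t)))
  (y : R -> 'cV[R[i]]_n) (hyc : {within `[T, +oo[, continuous y})
  (hy : ode_solution A (fun t => f t + g t) y [set t | T < t])
  (hlim : forall lam : R, Re_spectrum A lam -> lam < mu ->
     forall m : nat, (0 < m)%N ->
     t ^+ m * expR (lam * t) * enorm (y t) @[t --> +oo] --> (0 : R)) :
  exists2 z : R -> 'cV[R[i]]_n, F_E (- mu) z &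
  exists2 eps : R, 0 < eps &
    ode_solution A f z setT /\
    bigO_infty (fun t => y t - z t) (fun t => expR (- (mu + eps) * t)).
Proof.
have [P [L [Pu trigL PA]]] := complex_trigonalization A.
have [delta delta0 gO] := hg.
have [|k|k t Tt|k Lk|w [eps eps0 wP]] := @triangular_asymptotics R n L mu delta T
  (fun k t => (P *m f t) k 0) (fun k t => (P *m g t) k 0)
  (fun k t => (P *m y t) k 0) trigL delta0.
- move=> k; under eq_fun do rewrite mxE.
  by apply: quasipoly_sum => j _; apply/quasipolyZ/F_E_coord.
- under eq_fun do rewrite mxE.
  by apply: decays_sum => j _; apply/decaysZ/bigO_infty_decays.
- have [d /is_vderiveP dP dE] := hy t Tt.
  have := cderive_mulmx P k dP; congr cderive.
  have -> : d = f t + g t - A *m y t by rewrite -dE addrK.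
  by rewrite mulmxBr mulmxDr mulmxA PA -mulmxA !mxE.
- apply: cvg_mulmx_coord; apply: hlim => //.
  by exists (L k k) => //=; exact: eigenvalue_trig_diag PA.
pose wv t : 'cV[R[i]]_n := \col_k w k t.
(* The triangular solution is carried back to the original coordinates. *)
exists (fun t => invmx P *m wv t).
  have -> : (fun t => invmx P *m wv t) =
      (fun t => \col_k \sum_j invmx P k j * w j t).
    apply/funext => t; apply/colP => k; rewrite !mxE.
    by apply: eq_bigr => j _; rewrite mxE.
  apply: F_E_col => k; apply: quasipoly_sum => j _; apply: quasipolyZ.
  by have [] := wP j.
exists eps => //; split.
  move=> t _; exists (invmx P *m (P *m f t - L *m wv t)).
    apply/is_vderiveP => k; apply: cderive_mulmx => j.
    have [_ wd _] := wP j.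
    under eq_fun do rewrite mxE; have := wd t; congr cderive.
    rewrite !mxE; congr (_ - _); apply: eq_bigr => l _; by rewrite mxE.
  rewrite mulmxBr mulKmx//.
  (* The relation P A = L P, read on P applied to the preimage of [wv t]. *)
  have -> : invmx P *m (L *m wv t) = A *m (invmx P *m wv t).
    by rewrite -{1}[wv t](mulKVmx Pu) [L *m _]mulmxA -PA -mulmxA mulKmx.
  by rewrite subrK.
apply: decays_bigO_infty => k.
(* The error is the inverse of [P] applied to the error of the triangular system, so its coordinates
   are fixed combinations of decaying functions. *)
have -> : (fun t => (y t - invmx P *m wv t) k 0) =
    (fun t => \sum_j invmx P k j * ((P *m y t) j 0 - w j t)).
  apply/funext => t; rewrite -{1}[y t](mulKmx Pu) -mulmxBr mxE.
  by apply: eq_bigr => j _; rewrite !mxE.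
by apply: decays_sum => j _; apply: decaysZ; have [] := wP j.
Qed.
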